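(* Let $A : \mathbb{E} \to \mathbb{E}^*$ be a self-adjoint positive definite linear operator and let $G : \mathbb{E} \to \mathbb{E}^*$ be a self-adjoint linear operator such that $A \preceq G$. Let $e_1,\dots,e_n$ be a basis of $\mathbb{E}$, let $B = \left(\sum_{i=1}^n e_i e_i^*\right)^{-1}$, and let $\mu, L > 0$ be such that $$\mu B \preceq A \preceq L B.$$ Then, for any $\tau \in [0,1]$, we have $$\sigma_A\big(\mathrm{Broyd}_{\tau}(G, A, \bar{u}_A(G))\big) \leq \left(1 - \frac{\mu}{nL}\right)\sigma_A(G).$$
   Context: $\mathbb{E}$ is an $n$-dimensional real vector space, $\mathbb{E}^*$ its dual, and $\langle s, x\rangle$ is the value of $s \in \mathbb{E}^*$ at $x \in \mathbb{E}$. For self-adjoint $A, A_1 : \mathbb{E} \to \mathbb{E}^*$, $A \preceq A_1$ means $\langle (A_1 - A)x, x\rangle \ge 0$ for all $x \in \mathbb{E}$. For $u \in \mathbb{E}$, $u^*$ denotes the map $s \mapsto \langle s, u\rangle$ on $\mathbb{E}^*$; thus $uu^* : \mathbb{E}^*\to\mathbb{E}$ is $s \mapsto \langle s,u\rangle u$, and e.g. $Auu^*G$ is the operator $\mathbb{E}\to\mathbb{E}^*$, $x \mapsto \langle Gx, u\rangle Au$. For self-adjoint $W : \mathbb{E}^* \to \mathbb{E}$ and $A : \mathbb{E} \to \mathbb{E}^*$, $\langle W, A\rangle = \mathrm{Trace}(WA)$. For self-adjoint positive definite $A$, self-adjoint $G$ with $A \preceq G$, $u \in \mathbb{E}$ and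 $\tau \in \mathbb{R}$: if $Gu \ne Au$, define $$\mathrm{Broyd}_\tau(G,A,u) = \tau\left[G - \frac{Auu^*G + Guu^*A}{\langle Au,u\rangle} + \left(\frac{\langle Gu,u\rangle}{\langle Au,u\rangle}+1\right)\frac{Auu^*A}{\langle Au,u\rangle}\right] + (1-\tau)\left[G - \frac{(G-A)uu^*(G-A)}{\langle (G-A)u,u\rangle}\right],$$ and if $Gu = Au$, define $\mathrm{Broyd}_\tau(G,A,u) = G$. The measure of progress is $\sigma_A(G) = \langle A^{-1}, G - A\rangle = \langle A^{-1}, G\rangle - n$. The greedily selected direction (with respect to the fixed basis) is $$\bar{u}_A(G) = \operatorname*{argmax}_{u \in \{e_1,\dots,e_n\}} \frac{\langle (G-A)u,u\rangle}{\langle Au,u\rangle} = \operatorname*{argmax}_{u \in \{e_1,\dots,e_n\}} \frac{\langle Gu,u\rangle}{\langle Au,u\rangle},$$ i.e. any basis vector attaining the maximum. *)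

(* Defs.v *)
From HB Require Import structures.
From mathcomp Require Import all_boot all_order all_algebra.
From mathcomp Require Import reals.

Set Implicit Arguments.
Unset Strict Implicit.
Unset Printing Implicit Defensive.

Import Order.TTheory GRing.Theory Num.Theory.
Local Open Scope ring_scope.

Section Trace.
Context {F : fieldType} {E : vectType F}.

Definition lftrace (f : 'End(E)) : F :=
  \tr (passmx.mxof (vbasis {:E}) (vbasis {:E}) f).

Lemma lftrace_basis (e : (\dim {:E}).-tuple E) (f : 'End(E)) :
  basis_of {:E} e -> lftrace f = \tr (passmx.mxof e e f).
Proof.
move=> eb; have vb := vbasisP {:E}.
rewrite /lftrace -[f in LHS]comp_lfun1r (passmx.mxof_comp _ _ eb).
by rewrite mxtrace_mulC -(passmx.mxof_comp _ _ vb) comp_lfun1l.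
Qed.
End Trace.

Section Operators.
Context {R : realType} {E : vectType R}.

Local Notation dual := 'Hom(E, R^o).

Implicit Types (s : dual) (x y u v : E) (A G : 'Hom(E, dual)).

Definition pairing s x : R := s x.

Definition self_adjoint A := forall x y, pairing (A x) y = pairing (A y) x.

Definition pos_def A := forall x, x != 0 -> 0 < pairing (A x) x.

Definition loewner_le A G := forall x, 0 <= pairing ((G - A) x) x.

(* The operator u u^* : s |-> <s, u> u. *)
Definition outer_fun u : dual -> E := fun s => pairing s u *: u.

Lemma outer_fun_is_linear u : linear (outer_fun u).
Proof.
by move=> a s t; rewrite /outer_fun /pairing add_lfunE scale_lfunE scalerDl scalerA.
Qed.

HB.instance Definition _ u := GRing.isLinear.Build R dual E *:%R (outer_fun u)
  (outer_fun_is_linear u).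

Definition outer u : 'Hom(dual, E) := linfun (outer_fun u).

Lemma outerE u s : outer u s = pairing s u *: u.
Proof. exact: lfunE. Qed.

Definition dual_pairing (W : 'Hom(dual, E)) A : R := lftrace (W \o A)%VF.

Lemma lker0_dualV (A : 'Hom(E, dual)) :
  lker A == 0%VS -> (A^-1 \o A = \1)%VF /\ (A \o A^-1 = \1)%VF.
Proof.
move=> kA; split; first exact: lker0_compVf.
have fA : limg A = fullv.
  apply/eqP; rewrite eqEdim subvf /= limg_dim_eq ?(eqP kA) ?capv0 // !dimvf.
  by rewrite /dim /= muln1.
apply/lfunP=> s; rewrite comp_lfunE id_lfunE limg_lfunVK //.
by rewrite fA memvf.
Qed.

Lemma pos_def_inv A :
  pos_def A -> (A^-1 \o A = \1)%VF /\ (A \o A^-1 = \1)%VF.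
Proof.
move=> pA; apply: lker0_dualV; rewrite -subv0; apply/subvP=> x.
rewrite memv_ker memv0 => /eqP Ax0; apply: contraT => /pA.
by rewrite Ax0 /pairing lfunE /= ltxx.
Qed.

Definition sigma A G : R := dual_pairing (A^-1)%VF (G - A).

Definition broyd (tau : R) G A u : 'Hom(E, dual) :=
  if G u == A u then G else
  let au := pairing (A u) u in
  let gu := pairing (G u) u in
  tau *: (G - au^-1 *: ((A \o outer u \o G) + (G \o outer u \o A))%VF
            + ((gu / au + 1) / au) *: (A \o outer u \o A)%VF)
  + (1 - tau) *: (G - (pairing ((G - A) u) u)^-1 *:
                        ((G - A) \o outer u \o (G - A))%VF).

(* The maximizer need not be unique, hence a predicate on [u]. *)
Definition greedy_direction A G (n : nat) (e : n.-tuple E) u : Prop :=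
  u \in e /\
  forall v, v \in e ->
    pairing ((G - A) v) v / pairing (A v) v
      <= pairing ((G - A) u) u / pairing (A u) u.

Definition basis_operator (n : nat) (e : n.-tuple E) : 'Hom(E, dual) :=
  ((\sum_(i < n) outer (tnth e i))^-1)%VF.

Lemma basis_operatorK (n : nat) (e : n.-tuple E) :
  basis_of fullv e ->
  let S := \sum_(i < n) outer (tnth e i) in
  (basis_operator e \o S = \1)%VF /\ (S \o basis_operator e = \1)%VF.
Proof.
move=> eb S; have kS : lker S == 0%VS.
  rewrite -subv0; apply/subvP=> s; rewrite memv_ker memv0 => /eqP Ss0.
  have /freeP fe := basis_free eb.
  have se (i : 'I_n) : pairing s e`_i = 0.
    apply: (fe (fun j => pairing s e`_j)) => //.
    rewrite -[RHS]Ss0 sum_lfunE; apply: eq_bigr => j _.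
    by rewrite outerE (tnth_nth 0).
  apply/eqP/lfunP=> x; rewrite (coord_basis eb (memvf x)) !linear_sum /=.
  apply: eq_bigr => i _; rewrite !linearZ /=; congr (_ *: _).
  by rewrite zero_lfunE; exact: se.
split; first exact: lker0_compVf.
have fS : limg S = fullv.
  apply/eqP; rewrite eqEdim subvf /= limg_dim_eq ?(eqP kS) ?capv0 // !dimvf.
  by rewrite /dim /= muln1.
apply/lfunP=> x; rewrite comp_lfunE id_lfunE limg_lfunVK //.
by rewrite fS memvf.
Qed.

End Operators.

(* Main.v *)
From HB Require Import structures.
Require Import Defs.
From mathcomp Require Import all_boot all_order all_algebra.
From mathcomp Require Import ring lra.
From mathcomp Require Import reals.
From mathcomp Require Import boolp.
Import Order.TTheory GRing.Theory Num.Theory.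
Local Open Scope ring_scope.

(** Write [D = G - A], which is positive semidefinite, and
    [theta = <D u, u> / <A u, u>] for the greedy direction [u].  The contraction
    factor results from two estimates that have [theta] in common.

    - Progress of one update: [sigma] decreases by at least [theta], for any
      nonzero [u] ([sigma_broyd_le]).  By linearity of the trace, the bracket
      weighted by [tau] (the DFP update) decreases [sigma] by exactly [theta]
      ([sigma_dfp]), and the other one (the SR1 update) decreases it by
      [<D u, A^-1 D u> / <D u, u>], which is at least [theta] by the
      Cauchy-Schwarz inequality for [A] ([sigma_sr1]).

    - Quality of the greedy direction: [mu * sigma <= n * L * theta]
      ([sigma_le_ratio]).  Inverting [mu B <= A] gives
      [mu A^-1 <= \sum_i e_i e_i^*], and pairing with [D >= 0] gives
      [mu * sigma <= \sum_i <D e_i, e_i>].  Each summand is at most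
      [theta * <A e_i, e_i>] by the greedy choice, and
      [<A e_i, e_i> <= L <B e_i, e_i> = L].

    The second estimate needs the trace pairing of two positive semidefinite
    operators to be nonnegative ([dual_pairing_ge0]).  This is obtained without
    spectral theory or square roots, by peeling off rank-one terms
    [D x x^* D / <D x, x>] one at a time. *)

(** * The trace of an endomorphism *)

Section LinearTrace.
Set Implicit Arguments.
Unset Strict Implicit.
Context {F : fieldType} {E : vectType F}.
Implicit Types f g : 'End(E).

Lemma lftrace_is_linear : linear (@lftrace F E : 'End(E) -> F^o).
Proof. by move=> a f g; rewrite /lftrace passmx.mxof_linear linearP. Qed.

HB.instance Definition _ :=
  GRing.isLinear.Build F 'End(E) F^o *:%R (@lftrace F E) lftrace_is_linear.

Lemma lftraceE f :
  lftrace f = \sum_i coord (vbasis {:E}) i (f (vbasis {:E})`_i).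
Proof.
rewrite /lftrace /mxtrace; apply: eq_bigr => i _.
by rewrite /passmx.mxof !mxE /= passmx.vecof_delta.
Qed.

Lemma lftraceC {V : vectType F} (P : 'Hom(E, V)) (Q : 'Hom(V, E)) :
  lftrace (Q \o P)%VF = lftrace (P \o Q)%VF.
Proof.
have eb := vbasisP {:E}; have vb := vbasisP {:V}.
by rewrite /lftrace (passmx.mxof_comp _ _ vb) (passmx.mxof_comp _ _ eb)
  mxtrace_mulC.
Qed.

End LinearTrace.

(** * Positive semidefinite operators *)

Section Forms.
Set Implicit Arguments.
Unset Strict Implicit.
Context {R : realType} {E : vectType R}.
Local Notation dual := 'Hom(E, R^o).
Implicit Types (s t : dual) (u v x y : E) (A D G X Y : 'Hom(E, dual)).
Implicit Types (V W : 'Hom(dual, E)).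

Definition psd D := forall x, 0 <= pairing (D x) x.

Lemma pairing_rank_one X Y u x y :
  pairing ((X \o outer u \o Y)%VF x) y = pairing (Y x) u * pairing (X u) y.
Proof. by rewrite /pairing !comp_lfunE outerE linearZ /= scale_lfunE. Qed.

Lemma pairing_lin2 {D} (D_sa : self_adjoint D) (a b : R) x y :
  pairing (D (a *: x + b *: y)) (a *: x + b *: y) =
  a ^+ 2 * pairing (D x) x + 2 * a * b * pairing (D x) y
    + b ^+ 2 * pairing (D y) y.
Proof.
have := D_sa y x; rewrite /pairing !(linearD, linearZ) /= => Dyx.
rewrite !(add_lfunE, scale_lfunE) Dyx /GRing.scale /=; ring.
Qed.

(** The discriminant argument: the form is nonnegative on the span of [x] and
    [y].  The coefficients are chosen free of division, so that vectors on which
    the form vanishes are covered too. *)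
Lemma psd_cauchy_schwarz D x y : self_adjoint D -> psd D ->
  pairing (D x) y ^+ 2 <= pairing (D x) x * pairing (D y) y.
Proof.
move=> D_sa D_psd.
have Q a b : 0 <= a ^+ 2 * pairing (D x) x + 2 * a * b * pairing (D x) y
    + b ^+ 2 * pairing (D y) y.
  by rewrite -(pairing_lin2 D_sa) D_psd.
have := D_psd x; rewrite le_eqVlt => /predU1P[x0|x_gt0]; last first.
  by have := Q (- pairing (D x) y) (pairing (D x) x); nra.
have := D_psd y; rewrite le_eqVlt => /predU1P[y0|y_gt0]; last first.
  by have := Q (pairing (D y) y) (- pairing (D x) y); nra.
(* Both diagonal values vanish, and the form takes the value
   [- 2 <D x, y> ^ 2] at [x - <D x, y> y]. *)
by have := Q 1 (- pairing (D x) y); rewrite -x0 -y0; nra.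
Qed.

Lemma psd_eq0 D : self_adjoint D -> psd D ->
  (forall x, pairing (D x) x = 0) -> D = 0.
Proof.
move=> D_sa D_psd D0; apply/lfunP=> x; apply/lfunP=> y.
have := psd_cauchy_schwarz x y D_sa D_psd.
rewrite D0 mul0r zero_lfunE zero_lfunE => Dxy.
by apply/eqP; rewrite -sqrf_eq0 eq_le Dxy sqr_ge0.
Qed.

(** One step of a Cholesky factorization, in coordinate-free form: the Schur
    complement of [D] in the direction [x].  With [D = G - A] it is also the
    residual left by the SR1 update along [x].  When [<D x, x> = 0] the
    convention [0^-1 = 0] makes it [D] itself. *)
Definition deflate D x : 'Hom(E, dual) :=
  D - (pairing (D x) x)^-1 *: (D \o outer x \o D)%VF.

Lemma pairing_deflate D x y z : pairing (deflate D x y) z =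
  pairing (D y) z - pairing (D y) x * pairing (D x) z / pairing (D x) x.
Proof.
have := pairing_rank_one D D x y z; rewrite /pairing /deflate => DxD.
by rewrite !(add_lfunE, opp_lfunE, scale_lfunE) DxD [in RHS]mulrC.
Qed.

Lemma deflate_sa D x : self_adjoint D -> self_adjoint (deflate D x).
Proof.
move=> D_sa y z; rewrite !pairing_deflate (D_sa y z) (D_sa y x) (D_sa x z).
by rewrite [_ * pairing (D z) x]mulrC.
Qed.

(** Nonnegativity at [y] is the Cauchy-Schwarz inequality between [x] and [y]. *)
Lemma deflate_psd D x : self_adjoint D -> psd D -> psd (deflate D x).
Proof.
move=> D_sa D_psd y; rewrite pairing_deflate (D_sa x y) subr_ge0 -expr2.
have := D_psd x; rewrite le_eqVlt => /predU1P[<-|x_gt0].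
  by rewrite invr0 mulr0.
by rewrite ler_pdivrMr // psd_cauchy_schwarz.
Qed.

(** The kernel keeps all of [lker D] and gains [x], hence repeated deflation
    ends. *)
Lemma ltn_dim_lker_deflate D x : pairing (D x) x != 0 ->
  (\dim (lker D) < \dim (lker (deflate D x)))%N.
Proof.
move=> x0.
have sub : (lker D <= lker (deflate D x))%VS.
  apply/subvP=> y; rewrite !memv_ker => /eqP Dy; apply/eqP/lfunP=> z.
  have := pairing_deflate D x y z; rewrite Dy /pairing => ->.
  by rewrite !zero_lfunE !mul0r subr0.
have [le eq] := dimv_leqif_sup sub.
rewrite ltn_neqAle le andbT eq; apply/negP=> /subvP/(_ x).
rewrite !memv_ker => H; suff Dx : D x = 0.
  by move: x0; rewrite Dx /pairing zero_lfunE eqxx.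
apply/eqP/H/eqP/lfunP=> z.
rewrite zero_lfunE; transitivity (pairing (deflate D x x) z); first by [].
by rewrite pairing_deflate mulrAC mulfV // mul1r subrr.
Qed.

(** * The trace pairing *)

Lemma dual_pairing_is_linear W : linear (dual_pairing W : _ -> R^o).
Proof.
by move=> a X Y; rewrite /dual_pairing comp_lfunDr -comp_lfunZr linearP.
Qed.

HB.instance Definition _ W :=
  GRing.isLinear.Build R 'Hom(E, dual) R^o *:%R (dual_pairing W)
    (dual_pairing_is_linear W).

Lemma dual_pairingDl D V W :
  dual_pairing (V + W) D = dual_pairing V D + dual_pairing W D.
Proof. by rewrite /dual_pairing comp_lfunDl linearD. Qed.

Lemma dual_pairingZl D (a : R) W :
  dual_pairing (a *: W) D = a * dual_pairing W D.
Proof. by rewrite /dual_pairing -comp_lfunZl linearZ. Qed.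

Lemma dual_pairing_suml D (I : finType) (W : I -> 'Hom(dual, E)) :
  dual_pairing (\sum_i W i) D = \sum_i dual_pairing (W i) D.
Proof.
apply: (big_morph (fun V => dual_pairing V D) (dual_pairingDl D)).
by rewrite -[X in dual_pairing X](scale0r 0) dual_pairingZl mul0r.
Qed.

Lemma dual_pairing_outer u D : dual_pairing (outer u) D = pairing (D u) u.
Proof.
rewrite /dual_pairing lftraceE {2}(coord_vbasis (memvf u)).
rewrite /pairing linear_sum sum_lfunE; apply: eq_bigr => i _.
by rewrite comp_lfunE outerE !linearZ /= scale_lfunE /GRing.scale /= mulrC.
Qed.

(** Every correction term of the Broyden family has the form [X u u^* Y], so this
    identity evaluates all the traces in [sigma] of an update.  It is the
    cyclicity of the trace. *)
Lemma dual_pairing_rank_one W X Y u :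
  dual_pairing W (X \o outer u \o Y)%VF = pairing (Y (W (X u))) u.
Proof.
have := dual_pairing_outer u (Y \o (W \o X))%VF.
rewrite !comp_lfunE => <-; rewrite /dual_pairing.
by rewrite lftraceC -!comp_lfunA lftraceC -!comp_lfunA.
Qed.

(** The pairing of [W] with a rank-one term [D x x^* D] is [<D x, W (D x)>], which
    is nonnegative, and deflation writes [D] as a sum of such terms with positive
    weights. *)
Lemma dual_pairing_ge0 W D : (forall s, 0 <= pairing s (W s)) ->
  self_adjoint D -> psd D -> 0 <= dual_pairing W D.
Proof.
move=> W_psd.
have [m] := ubnP (\dim {:E} - \dim (lker D))%N.
elim: m D => // m IHm D; rewrite ltnS => le_m D_sa D_psd.
have [D0|/existsNP[x /eqP x0]] := pselect (forall x, pairing (D x) x = 0).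
  by rewrite (psd_eq0 D_sa) // linear0.
have x_gt0 : 0 < pairing (D x) x by rewrite lt_def x0 D_psd.
have -> : D = deflate D x + (pairing (D x) x)^-1 *: (D \o outer x \o D)%VF.
  by rewrite subrK.
rewrite linearD linearZ /= addr_ge0 //; last first.
  rewrite /GRing.scale /= dual_pairing_rank_one mulr_ge0 ?invr_ge0 ?D_psd //.
  by rewrite D_sa W_psd.
apply: IHm; [|exact: deflate_sa|exact: deflate_psd].
apply: leq_trans le_m; rewrite ltn_sub2l ?ltn_dim_lker_deflate //.
by apply: leq_trans (ltn_dim_lker_deflate x0) _; rewrite dimvS // subvf.
Qed.

Lemma pos_def_invK A x : pos_def A -> (A^-1)%VF (A x) = x.
Proof. by move=> /pos_def_inv[VA _]; rewrite -comp_lfunE VA id_lfunE. Qed.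

Lemma pos_def_Kinv A s : pos_def A -> A ((A^-1)%VF s) = s.
Proof. by move=> /pos_def_inv[_ AV]; rewrite -comp_lfunE AV id_lfunE. Qed.

(** * Quality of the greedy direction *)

Section Basis.
Context {n : nat} (e : n.-tuple E).
Hypothesis e_basis : basis_of fullv e.
Local Notation B := (basis_operator e).
Local Notation S := (\sum_(i < n) outer (tnth e i)).

Lemma pairing_sum_outer s t :
  pairing t (S s) = \sum_(i < n) pairing s (tnth e i) * pairing t (tnth e i).
Proof.
rewrite /pairing sum_lfunE linear_sum; apply: eq_bigr => i _.
by rewrite outerE linearZ.
Qed.

Lemma basis_operator_KS x : S (B x) = x.
Proof.
by have [_ SB] := basis_operatorK e_basis; rewrite -comp_lfunE SB id_lfunE.
Qed.

Lemma basis_operator_SK s : B (S s) = s.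
Proof.
by have [BS _] := basis_operatorK e_basis; rewrite -comp_lfunE BS id_lfunE.
Qed.

(** [B] is the Gram form of the functionals [x |-> <B x, e_i>], which makes its
    symmetry and positivity visible. *)
Lemma pairing_basis_operator x y : pairing (B x) y =
  \sum_(i < n) pairing (B x) (tnth e i) * pairing (B y) (tnth e i).
Proof.
rewrite -[in LHS](basis_operator_KS y) pairing_sum_outer.
by apply: eq_bigr => i _; rewrite mulrC.
Qed.

Lemma basis_operator_sa : self_adjoint B.
Proof.
move=> x y; rewrite pairing_basis_operator [RHS]pairing_basis_operator.
by apply: eq_bigr => i _; rewrite mulrC.
Qed.

Lemma basis_operator_psd : psd B.
Proof.
move=> x; rewrite pairing_basis_operator sumr_ge0 // => i _.
by rewrite -expr2 sqr_ge0.
Qed.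

(** [B e_i] is the [i]-th vector of the dual basis: compare the coordinates of
    [e_i] and of [S (B e_i) = \sum_j <B e_i, e_j> e_j]. *)
Lemma basis_operator_diag i : pairing (B (tnth e i)) (tnth e i) = 1.
Proof.
have fe := basis_free e_basis.
have := basis_operator_KS (tnth e i); rewrite sum_lfunE.
under eq_bigr do rewrite outerE [in X in _ *: X](tnth_nth 0).
move=> /(congr1 (coord e i)); rewrite coord_sum_free // (tnth_nth 0) => ->.
by rewrite coord_free // eqxx.
Qed.

(** Inversion reverses the order: [mu B <= A] gives [mu A^-1 <= B^-1].  With
    [x = A^-1 s] and [y = S s] one has [A x = B y = s], and the claim follows by
    expanding [0 <= <B (y - mu x), y - mu x>] and using
    [mu <B x, x> <= <A x, x> = <s, x>]. *)
Lemma pairing_inv_le {A} {mu : R} (A_pd : pos_def A) (mu_gt0 : 0 < mu)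
    (muB_A : loewner_le (mu *: B) A) s :
  mu * pairing s ((A^-1)%VF s) <= pairing s (S s).
Proof.
set x := (A^-1)%VF s; set y := S s.
have Ax : A x = s by exact: pos_def_Kinv.
have By : B y = s by rewrite basis_operator_SK.
have := muB_A x; have := basis_operator_psd (1 *: y + (- mu) *: x).
rewrite pairing_lin2; last exact: basis_operator_sa.
rewrite By /pairing !(add_lfunE, opp_lfunE, scale_lfunE) Ax.
rewrite /GRing.scale /=; nra.
Qed.

Lemma dual_pairing_inv_le {A D} {mu : R} (A_pd : pos_def A) (mu_gt0 : 0 < mu)
    (muB_A : loewner_le (mu *: B) A) (D_sa : self_adjoint D) (D_psd : psd D) :
  mu * dual_pairing (A^-1)%VF D <=
    \sum_(i < n) pairing (D (tnth e i)) (tnth e i).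
Proof.
have : 0 <= dual_pairing ((- mu) *: A^-1%VF + S) D.
  apply: dual_pairing_ge0 => // s.
  have := pairing_inv_le A_pd mu_gt0 muB_A s; rewrite /pairing.
  rewrite !(add_lfunE, scale_lfunE) linearD linearZ /= /GRing.scale /=.
  by rewrite mulNr addrC subr_ge0.
rewrite dual_pairingDl dual_pairingZl dual_pairing_suml mulNr addrC subr_ge0.
by under eq_bigr do rewrite dual_pairing_outer.
Qed.

(** The bound holds for every [theta] that dominates the ratios
    [<(G - A) e_i, e_i> / <A e_i, e_i>]; the greedy direction gives the least
    one. *)
Lemma sigma_le_ratio A G (mu L theta : R) (A_pd : pos_def A)
    (D_sa : self_adjoint (G - A)) (D_psd : psd (G - A)) (mu_gt0 : 0 < mu)
    (muB_A : loewner_le (mu *: B) A) (A_LB : loewner_le A (L *: B)) :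
  0 <= theta ->
  (forall v, v \in (e : seq E) ->
     pairing ((G - A) v) v <= theta * pairing (A v) v) ->
  mu * sigma A G <= n%:R * L * theta.
Proof.
move=> theta_ge0 ratio.
apply: le_trans (dual_pairing_inv_le A_pd mu_gt0 muB_A D_sa D_psd) _.
have -> : n%:R * L * theta = \sum_(i < n) L * theta.
  by rewrite sumr_const card_ord -[RHS]mulr_natl mulrA.
apply: ler_sum => i _; apply: le_trans (ratio _ (mem_tnth i e)) _.
rewrite mulrC ler_wpM2r //; have := A_LB (tnth e i).
have := basis_operator_diag i.
rewrite /pairing !(add_lfunE, opp_lfunE, scale_lfunE) => ->.
by rewrite /GRing.scale /= mulr1 subr_ge0.
Qed.

End Basis.

(** * Progress of one update *)

(** Cauchy-Schwarz for the dual norms of [A], which is the primal inequality at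
    [A^-1 s]. *)
Lemma inv_cauchy_schwarz A s u : self_adjoint A -> pos_def A ->
  pairing s u ^+ 2 <= pairing s ((A^-1)%VF s) * pairing (A u) u.
Proof.
move=> A_sa A_pd; have := pos_def_Kinv s A_pd; move: ((A^-1)%VF s) => w <-.
apply: psd_cauchy_schwarz => // x; have [->|/A_pd/ltW//] := eqVneq x 0.
by rewrite /pairing linear0.
Qed.

(** Since [A^-1] cancels [A], the two mixed terms each contribute [gu / au] and
    the last one [gu / au + 1], so that [sigma] changes by
    [1 - gu / au = - <(G - A) u, u> / au]. *)
Lemma sigma_dfp A G u : pos_def A -> u != 0 ->
  let au := pairing (A u) u in let gu := pairing (G u) u in
  sigma A (G - au^-1 *: ((A \o outer u \o G) + (G \o outer u \o A))%VF
            + ((gu / au + 1) / au) *: (A \o outer u \o A)%VF) =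
  sigma A G - pairing ((G - A) u) u / au.
Proof.
move=> A_pd u0 au gu; have au_gt0 : 0 < au by exact: A_pd.
rewrite /sigma addrAC -[G - _ - A]addrAC.
rewrite [LHS]linearD /= [X in X + _]linearB /= !linearZ /=.
rewrite [dual_pairing _ (_ \o _ + _)%VF]linearD /= !dual_pairing_rank_one.
rewrite !pos_def_invK // pos_def_Kinv //.
rewrite /pairing add_lfunE add_lfunE opp_lfunE opp_lfunE /GRing.scale /=.
rewrite -!/(pairing _ _) -/au -/gu; field.
by rewrite gt_eqF.
Qed.

(** With [D = G - A], the decrease is [<D u, A^-1 D u> / <D u, u>], to be compared
    with [<D u, u> / <A u, u>]: this is [inv_cauchy_schwarz] at [s = D u]. *)
Lemma sigma_sr1 A G u : self_adjoint A -> pos_def A ->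
  self_adjoint (G - A) -> psd (G - A) -> u != 0 ->
  sigma A (G - (pairing ((G - A) u) u)^-1 *:
                        ((G - A) \o outer u \o (G - A))%VF) <=
  sigma A G - pairing ((G - A) u) u / pairing (A u) u.
Proof.
move=> A_sa A_pd D_sa D_psd u0.
have au_gt0 : 0 < pairing (A u) u by exact: A_pd.
rewrite /sigma addrAC; set D := G - A in D_sa D_psd *.
rewrite linearB linearZ /= dual_pairing_rank_one (D_sa ((A^-1)%VF _)).
rewrite lerD2l lerN2 /GRing.scale /=.
have := D_psd u; rewrite le_eqVlt => /predU1P[<-|d_gt0].
  by rewrite invr0 !mul0r.
rewrite ler_pdivrMr // -mulrA [leRHS]mulrC ler_pdivlMr // -expr2.
exact: inv_cauchy_schwarz.
Qed.

(** In the degenerate case [G u = A u] the update leaves [G] unchanged, and the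
    ratio on the right vanishes with it. *)
Lemma sigma_broyd_le A G (tau : R) u : self_adjoint A -> pos_def A ->
  self_adjoint (G - A) -> psd (G - A) -> u != 0 -> 0 <= tau -> tau <= 1 ->
  sigma A (broyd tau G A u) <=
  sigma A G - pairing ((G - A) u) u / pairing (A u) u.
Proof.
move=> A_sa A_pd D_sa D_psd u0 t0 t1; rewrite /broyd.
case: eqP => [Gu|_].
  by rewrite /pairing add_lfunE opp_lfunE Gu subrr zero_lfunE mul0r subr0.
have sigma_conv P Q : sigma A (tau *: P + (1 - tau) *: Q) =
    tau * sigma A P + (1 - tau) * sigma A Q.
  rewrite /sigma.
  have -> : tau *: P + (1 - tau) *: Q - A =
      tau *: (P - A) + (1 - tau) *: (Q - A).
    rewrite !scalerBr addrACA -opprD -scalerDl [tau + _]addrC subrK.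
    by rewrite scale1r.
  by rewrite linearD !linearZ.
rewrite sigma_conv sigma_dfp //.
have := sigma_sr1 A_sa A_pd D_sa D_psd u0; nra.
Qed.

End Forms.

(** * The contraction rate *)

Theorem theorem2p5 (R : realType) (E : vectType R)
  (A G : 'Hom(E, 'Hom(E, R^o)))
  (A_sa : self_adjoint A) (A_pd : pos_def A)
  (G_sa : self_adjoint G) (AG : loewner_le A G)
  (n : nat) (e : n.-tuple E) (e_basis : basis_of fullv e)
  (mu L : R) (mu_gt0 : 0 < mu) (L_gt0 : 0 < L)
  (muB_A : loewner_le (mu *: basis_operator e) A)
  (A_LB : loewner_le A (L *: basis_operator e))
  (tau : R) (tau_ge0 : 0 <= tau) (tau_le1 : tau <= 1)
  (u : E) (u_greedy : greedy_direction A G e u) :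
  sigma A (broyd tau G A u) <= (1 - mu / (n%:R * L)) * sigma A G.
Proof.
have [u_e u_max] := u_greedy.
have ne0 v : v \in (e : seq E) -> v != 0.
  by move=> v_e; apply: free_not0 (basis_free e_basis) v_e.
have n_gt0 : 0 < n%:R :> R.
  by rewrite ltr0n; case: (n) (e) u_e => // e0; rewrite tuple0.
have D_sa : self_adjoint (G - A).
  move=> x y; have := A_sa x y; have := G_sa x y; rewrite /pairing.
  by rewrite !(add_lfunE, opp_lfunE) => -> ->.
have D_psd : psd (G - A) by exact: AG.
set theta := pairing ((G - A) u) u / pairing (A u) u in u_max.
have theta_ge0 : 0 <= theta by rewrite divr_ge0 // ltW // A_pd // ne0.
have sigma_le : mu * sigma A G <= n%:R * L * theta.
  apply: (sigma_le_ratio e_basis) => // v v_e.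
  by rewrite -ler_pdivrMr ?u_max // A_pd // ne0.
have progress := sigma_broyd_le A_sa A_pd D_sa D_psd (ne0 _ u_e) tau_ge0 tau_le1.
apply: le_trans progress _.
rewrite mulrBl mul1r lerD2l lerN2 mulrAC ler_pdivrMr ?mulr_gt0 // -/theta.
by rewrite [theta * _]mulrC.
Qed.
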